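(* Let $K$ and $L$ be two convex bodies in $\mathbb{R}^3$, each having countably many diameters. Assume that there exists a diameter $d_K(\xi_0)$ of $K$, parallel to a direction $\xi_0\in S^2$, such that for every unit vector $w\in\xi_0^\perp$ (i.e. for every two-dimensional subspace $w^\perp$ containing $\xi_0$) the projections $K|w^\perp$ and $L|w^\perp$ are directly congruent. Assume also that these projections are not centrally symmetric, i.e. for every unit vector $w\in\xi_0^\perp$ neither $K|w^\perp$ nor $L|w^\perp$ is centrally symmetric. Then there exists $b\in\mathbb{R}^3$ such that $K=L+b$ or $K=-L+b$.
   Context: A convex body is a compact convex set with non-empty interior. The support function of a convex body $K$ is $h_K(x)=\max\{x\cdot y: y\in K\}$, and its width function is $\omega_K(x)=h_K(x)+h_K(-x)$ for $x\in S^2$. A segment $[z,y]\subset K$ is a diameter of $K$ if $|z-y|=\max_{\theta\in S^2}\omega_K(\theta)$; a convex body has at most one diameter parallel to a given direction $\zeta\in S^2$, denoted $d_K(\zeta)$ when it exists. $K$ has countably many diameters if $\omega_K$ reaches its maximum on a countable (possibly finite) subset of $S^2$. For a unit vector $w$, $w^\perp=\{x\in\mathbb{R}^3: x\cdot w=0\}$ and $K|w^\perp$ is the orthogonal projection of $K$ onto $w^\perp$. Two subsets $A,B$ of the plane $w^\perp$ are directly congruent if they coincide up to a rotation and a translation: there exist $\varphi\in SO(2,w^\perp)$ (a rotation of the plane $w^\perp$ around the origin) and $a\in w^\perp$ with $\varphi(A)+a=B$. A set is centrally symmetric if it is symmetric with respect to some point. *)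

(* Defs.v *)
From HB Require Import structures.
From mathcomp Require Import all_boot all_order all_algebra.
From mathcomp Require Import all_classical all_reals all_analysis.

Set Implicit Arguments.
Unset Strict Implicit.
Unset Printing Implicit Defensive.

Import Order.TTheory GRing.Theory Num.Theory.
Import numFieldNormedType.Exports.

Local Open Scope classical_set_scope.
Local Open Scope ring_scope.

Definition dotv (R : realType) (x y : 'rV[R]_3) : R := (x *m y^T) 0 0.

(* The library norm `|x| on row vectors is the sup norm; its topology is the
   usual one, but lengths are Euclidean. *)
Definition enorm (R : realType) (x : 'rV[R]_3) : R := Num.sqrt (dotv x x).

Definition unit_sphere (R : realType) : set 'rV[R]_3 := [set x | enorm x = 1].

Definition convex_body (R : realType) (K : set 'rV[R]_3) : Prop :=
  [/\ compact K, convex_set K & interior K !=set0].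

(* On convex bodies the suprema in [support_fun] and [max_width] are maxima. *)
Definition support_fun (R : realType) (K : set 'rV[R]_3) (x : 'rV[R]_3) : R :=
  sup [set dotv x y | y in K].

Definition width_fun (R : realType) (K : set 'rV[R]_3) (x : 'rV[R]_3) : R :=
  support_fun K x + support_fun K (- x).

Definition max_width (R : realType) (K : set 'rV[R]_3) : R :=
  sup [set width_fun K t | t in @unit_sphere R].

Definition line_segment (R : realType) (z y : 'rV[R]_3) : set 'rV[R]_3 :=
  [set (1 - t) *: z + t *: y | t in `[0 : R, 1]].

Definition is_diameter (R : realType) (K : set 'rV[R]_3)
    (z y : 'rV[R]_3) : Prop :=
  line_segment z y `<=` K /\ enorm (z - y) = max_width K.

Definition has_diameter_along (R : realType) (K : set 'rV[R]_3)
    (xi : 'rV[R]_3) : Prop :=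
  exists z y : 'rV[R]_3, is_diameter K z y /\ exists c : R, z - y = c *: xi.

Definition countably_many_diameters (R : realType) (K : set 'rV[R]_3) : Prop :=
  countable [set t | unit_sphere t /\ width_fun K t = max_width K].

Definition orth_plane (R : realType) (w : 'rV[R]_3) : set 'rV[R]_3 :=
  [set x | dotv x w = 0].

(* This is the orthogonal projection onto [orth_plane w] only for unit w. *)
Definition orth_proj (R : realType) (w : 'rV[R]_3) (K : set 'rV[R]_3) :
    set 'rV[R]_3 :=
  [set x - dotv x w *: w | x in K].

(* SO(2, w^perp): a rotation of the plane w^perp is encoded by its extension to
   R^3 fixing w, i.e. by an element of SO(3) (acting on row vectors on the
   right) that fixes w. Orthogonality makes it preserve w^perp, and its
   restriction to w^perp then has determinant 1. *)
Definition plane_rotation (R : realType) (w : 'rV[R]_3) (M : 'M[R]_3) : Prop :=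
  [/\ M *m M^T = 1%:M, \det M = 1 & w *m M = w].

Definition directly_congruent (R : realType) (w : 'rV[R]_3)
    (A B : set 'rV[R]_3) : Prop :=
  exists (M : 'M[R]_3) (a : 'rV[R]_3),
    [/\ plane_rotation w M, orth_plane w a & [set x *m M + a | x in A] = B].

Definition centrally_symmetric (R : realType) (A : set 'rV[R]_3) : Prop :=
  exists c : 'rV[R]_3, [set c *+ 2 - x | x in A] = A.

(* Main.v *)
(* Both bodies have maximal width along xi0, so each has a unique point in its
   extreme supporting planes orthogonal to xi0.  The rotation matching K|w^perp
   with L|w^perp sends xi0 to a direction of maximal width of L; as there are
   only countably many of these, it is plus or minus the identity for all but
   countably many w.  Comparing the extreme points then fixes the translation:
   with b = zL - zK or b = yL + zK, not depending on w (zK is the top point of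
   K, zL and yL are the top and bottom points of L), h_L(x) = h_K(s x) + x.b on
   w^perp with s = 1, resp. s = -1.  Both alternatives are closed in w, they
   exclude each other because the projections are not centrally symmetric, and
   together they hold off a countable set; by connectedness one of them holds
   for every w, which determines h_L. *)

Require Import Defs.
From HB Require Import structures.
From mathcomp Require Import all_boot all_order all_algebra.
From mathcomp Require Import all_classical all_reals all_analysis.
From mathcomp Require Import ring lra.

Set Implicit Arguments.
Unset Strict Implicit.
Unset Printing Implicit Defensive.

Import Order.TTheory GRing.Theory Num.Theory.
Import numFieldNormedType.Exports.

Local Open Scope classical_set_scope.
Local Open Scope ring_scope.

(** * The Euclidean inner product and norm on row vectors *)

Section Euclidean.
Variable R : realType.
Implicit Types (x y z : 'rV[R]_3) (a : R) (M : 'M[R]_3).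

Lemma dotvE x y : dotv x y = \sum_i x 0 i * y 0 i.
Proof. by rewrite /dotv mxE; apply: eq_bigr => i _; rewrite mxE. Qed.

Lemma dotvC x y : dotv x y = dotv y x.
Proof. by rewrite !dotvE; apply: eq_bigr => i _; rewrite mulrC. Qed.

Lemma dotvDl x y z : dotv (x + y) z = dotv x z + dotv y z.
Proof. by rewrite /dotv mulmxDl mxE. Qed.

Lemma dotvZl a x y : dotv (a *: x) y = a * dotv x y.
Proof. by rewrite /dotv -scalemxAl mxE. Qed.

Lemma dotvNl x y : dotv (- x) y = - dotv x y.
Proof. by rewrite -scaleN1r dotvZl mulN1r. Qed.

Lemma dotvDr x y z : dotv z (x + y) = dotv z x + dotv z y.
Proof. by rewrite dotvC dotvDl !(dotvC _ z). Qed.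

Lemma dotvZr a x y : dotv x (a *: y) = a * dotv x y.
Proof. by rewrite dotvC dotvZl dotvC. Qed.

Lemma dotvNr x y : dotv x (- y) = - dotv x y.
Proof. by rewrite dotvC dotvNl dotvC. Qed.

Definition dotv_linE := (dotvDl, dotvDr, dotvNl, dotvNr, dotvZl, dotvZr).

Lemma dotv_sqD x y a : dotv (x + a *: y) (x + a *: y) =
  dotv x x + a * dotv x y *+ 2 + a * (a * dotv y y).
Proof. by rewrite !dotv_linE (dotvC y x); ring. Qed.

Lemma dotvMl x y M : dotv (x *m M) y = dotv x (y *m M^T).
Proof. by rewrite /dotv trmx_mul trmxK mulmxA. Qed.

Lemma dotv_ge0 x : 0 <= dotv x x.
Proof. by rewrite dotvE sumr_ge0 // => i _; rewrite -expr2 sqr_ge0. Qed.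

Lemma dotv_eq0 x : (dotv x x == 0) = (x == 0).
Proof.
apply/eqP/eqP => [|->]; last by rewrite /dotv mul0mx mxE.
rewrite dotvE => /psumr_eq0P h; apply/rowP => i; rewrite mxE.
have /eqP : x 0 i * x 0 i = 0.
  by apply: h => // j _; rewrite -expr2 sqr_ge0.
by rewrite -expr2 sqrf_eq0 => /eqP.
Qed.

Lemma enorm_ge0 x : 0 <= enorm x.
Proof. exact: sqrtr_ge0. Qed.

Lemma enorm_sqr x : enorm x ^+ 2 = dotv x x.
Proof. by rewrite sqr_sqrtr ?dotv_ge0. Qed.

Lemma enorm_eq0 x : (enorm x == 0) = (x == 0).
Proof. by rewrite -sqrf_eq0 enorm_sqr dotv_eq0. Qed.

Lemma unit_sphereE x : unit_sphere x <-> dotv x x = 1.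
Proof.
rewrite /unit_sphere /=; split=> [h|h]; first by rewrite -enorm_sqr h expr1n.
by rewrite /enorm h sqrtr1.
Qed.

Lemma unit_sphereN x : unit_sphere x -> unit_sphere (- x).
Proof. by rewrite !unit_sphereE dotvNl dotvNr opprK. Qed.

Lemma unit_sphere_normalize x : x != 0 -> unit_sphere ((enorm x)^-1 *: x).
Proof.
move=> x0; apply/unit_sphereE; rewrite dotvZl dotvZr -enorm_sqr.
by field; rewrite enorm_eq0.
Qed.

(** Cauchy-Schwarz: the square of [|y| x - |x| y] is nonnegative, and for nonzero vectors the factor
    [|x| |y|] cancels. *)
Lemma dotv_le_enorm x y : dotv x y <= enorm x * enorm y.
Proof.
have [->|y0] := eqVneq y 0.
  by rewrite -(scale0r 0) dotvZr mul0r mulr_ge0 ?enorm_ge0.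
have ypos : 0 < enorm y by rewrite lt_def enorm_eq0 y0 enorm_ge0.
have := dotv_ge0 (enorm y *: x - enorm x *: y).
rewrite !dotv_linE -!enorm_sqr (dotvC y x) => h.
have [x0|x0] := eqVneq x 0.
  by rewrite x0 -(scale0r 0) dotvZl mul0r mulr_ge0 ?enorm_ge0.
have xpos : 0 < enorm x by rewrite lt_def enorm_eq0 x0 enorm_ge0.
rewrite -(ler_pM2l (mulr_gt0 xpos ypos)); lra.
Qed.

Lemma dotv_continuous x : continuous (dotv x).
Proof.
have -> : dotv x = fun y => \sum_i x 0 i * y 0 i.
  by apply/funext => y; rewrite dotvE.
apply: (@continuous_big R 'I_3 +%R 0 predT _ 'rV[R]_3) => [|i _ y].
  exact: (@add_continuous R^o).
apply: (@continuousM R _ (fun=> x 0 i) (fun y : 'rV[R]_3 => y 0 i)).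
  exact: cst_continuous.
exact: coord_continuous.
Qed.

Lemma dist_continuous x : continuous (fun y => dotv (y - x) (y - x)).
Proof.
have -> : (fun y => dotv (y - x) (y - x)) =
    fun y => \sum_i (y 0 i - x 0 i) * (y 0 i - x 0 i).
  by apply/funext => y; rewrite dotvE; apply: eq_bigr => i _; rewrite !mxE.
apply: (@continuous_big R 'I_3 +%R 0 predT _ 'rV[R]_3) => [|i _ y].
  exact: (@add_continuous R^o).
by apply: (@continuousM R _ (fun z : 'rV[R]_3 => z 0 i - x 0 i));
  apply: (@continuousB R _ _ (fun z : 'rV[R]_3 => z 0 i) (fun=> x 0 i));
  (exact: coord_continuous || exact: cst_continuous).
Qed.

End Euclidean.

(** * Support and width functions of compact sets *)

Section SupportFunction.
Variable R : realType.
Implicit Types (K : set 'rV[R]_3) (x y z p q xi : 'rV[R]_3) (a t : R).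

Lemma support_fun_ge K x y : compact K -> K y -> dotv x y <= support_fun K x.
Proof.
move=> cK Ky; apply: sup_upper_bound; last by exists y.
apply: compact_has_sup; first by exists (dotv x y), y.
apply: continuous_compact cK; apply: continuous_subspaceT.
exact: dotv_continuous.
Qed.

Lemma support_fun_attained K x : compact K -> K !=set0 ->
  exists2 y, K y & support_fun K x = dotv x y.
Proof.
move=> cK K0.
have [|y yK ymax] := @EVT_max_rV _ _ (dotv x) K K0 cK.
  by apply: continuous_subspaceT; exact: dotv_continuous.
exists y; first exact/set_mem.
apply/eqP; rewrite eq_le support_fun_ge ?andbT //; last exact/set_mem.
apply: ge_sup; first by case: K0 => z Kz; exists (dotv x z), z.
by move=> _ [z Kz <-]; apply/ymax/mem_set.
Qed.

Lemma support_fun_le K x a : compact K -> K !=set0 ->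
  (forall y, K y -> dotv x y <= a) -> support_fun K x <= a.
Proof.
by move=> cK K0 h; have [y Ky ->] := support_fun_attained x cK K0; exact: h.
Qed.

Lemma convex_setP K x y t : convex_set K -> K x -> K y -> 0 <= t -> t <= 1 ->
  K (t *: x + (1 - t) *: y).
Proof.
move=> vK Kx Ky t0 t1.
exact: set_mem (vK x y (Itv01 t0 t1) (mem_set Kx) (mem_set Ky)).
Qed.

(** Separation argument: if [q] is not in [K], let [p] be the point of [K] nearest to [q]. The
    hypothesis in the direction [q - p] then yields a point of [K] nearer to [q] than [p]. *)
Lemma mem_support_fun K q : compact K -> convex_set K -> K !=set0 ->
  (forall x, dotv x q <= support_fun K x) -> K q.
Proof.
move=> cK vK K0 hq.
have [|p pK pmin] := @EVT_min_rV _ _ (fun y => dotv (y - q) (y - q)) K K0 cK.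
  by apply: continuous_subspaceT; exact: dist_continuous.
have Kp := set_mem pK.
have [<-//|pq] := eqVneq p q; exfalso.
have d0 : 0 < dotv (p - q) (p - q).
  by rewrite lt_def dotv_ge0 dotv_eq0 subr_eq0 pq.
have [y Ky hy] := support_fun_attained (q - p) cK K0.
have {hq} := hq (q - p); rewrite hy => {}hy.
have N0 := dotv_ge0 (y - p).
set d := dotv (p - q) (p - q) in d0.
set N := dotv (y - p) (y - p) in N0.
(* With this t, moving from the nearest point p towards y by t (y - p) would
   strictly decrease the distance to q. *)
pose t := d / (N + d).
have Nd : 0 < N + d by rewrite ltr_wpDl.
have t0 : 0 < t by rewrite divr_gt0.
have t1 : t <= 1 by rewrite ler_pdivrMr // mul1r lerDr.
have tN : t * N <= d.
  by rewrite /t mulrAC ler_pdivrMr // ler_pM2l // lerDl ltW.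
have /mem_set/pmin := convex_setP vK Ky Kp (ltW t0) t1.
have -> : t *: y + (1 - t) *: p - q = (p - q) + t *: (y - p).
  by rewrite scalerBl scale1r scalerBr; apply/rowP => i; rewrite !mxE; ring.
(* Since [y] is a maximiser in the direction [q - p], the hypothesis reads
   [(q - p).(q - y) <= 0]. *)
have c1 : dotv (p - q) (y - p) <= - d.
  move: hy; rewrite /d !dotv_linE (dotvC q p); lra.
rewrite dotv_sqD -/d -/N.
have tc : t * dotv (p - q) (y - p) <= t * (- d) by rewrite ler_pM2l.
have tN2 : t * (t * N) <= t * d by rewrite ler_pM2l.
have td : 0 < t * d by rewrite mulr_gt0.
lra.
Qed.

(** The products [q.y] are bounded over [K], so the function is Lipschitz in [s]: a maximiser for
    one parameter is a competitor for the other. *)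
Lemma support_fun_line_continuous K p q : compact K -> K !=set0 ->
  continuous (fun s : R => support_fun K (p + s *: q)).
Proof.
move=> cK K0.
(* The summand 1 makes [C] positive, so that one can divide by it. *)
pose C := `|support_fun K q| + `|support_fun K (- q)| + 1.
have C0 : 0 < C by rewrite ltr_wpDl // addr_ge0.
have qC y : K y -> `|dotv q y| <= C.
  move=> Ky; have := support_fun_ge q cK Ky.
  have := support_fun_ge (- q) cK Ky; rewrite dotvNl => h1 h2.
  have h3 := ler_norm (support_fun K q).
  have h4 := ler_norm (support_fun K (- q)).
  have h5 := normr_ge0 (support_fun K q).
  have h6 := normr_ge0 (support_fun K (- q)).
  by rewrite ler_norml /C; apply/andP; split; lra.
have lip s s' :
    support_fun K (p + s *: q) - support_fun K (p + s' *: q) <= C * `|s - s'|.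
  have [y Ky ->] := support_fun_attained (p + s *: q) cK K0.
  have := support_fun_ge (p + s' *: q) cK Ky.
  have : (s - s') * dotv q y <= C * `|s - s'|.
    by rewrite (le_trans (ler_norm _)) // normrM mulrC ler_wpM2r // qC.
  by rewrite !dotv_linE; lra.
move=> s; apply/cvgrPdist_le => e e0.
near=> s'.
have ss' : C * `|s - s'| <= e.
  rewrite mulrC -ler_pdivlMr //; near: s'.
  have := @cvgr_dist_le _ _ _ _ _ (@id R) s (@cvg_id _ (nbhs s)).
  by apply; rewrite divr_gt0.
have := lip s s'; have := lip s' s; rewrite (distrC s' s) => h1 h2.
by rewrite ler_norml; apply/andP; split; lra.
Unshelve. all: by end_near. Qed.

Lemma width_fun_dist K x : compact K -> K !=set0 ->
  exists z y, [/\ K z, K y, width_fun K x = dotv x (z - y),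
    support_fun K x = dotv x z & support_fun K (- x) = - dotv x y].
Proof.
move=> cK K0; have [z Kz hz] := support_fun_attained x cK K0.
have [y Ky hy] := support_fun_attained (- x) cK K0.
by exists z, y; rewrite /width_fun hz hy dotvNl dotvDr dotvNr.
Qed.

Lemma width_funN K x : width_fun K (- x) = width_fun K x.
Proof. by rewrite /width_fun opprK addrC. Qed.

Lemma width_fun_ge K x y z : compact K -> K y -> K z ->
  dotv x (y - z) <= width_fun K x.
Proof.
move=> cK Ky Kz; rewrite dotvDr dotvNr -dotvNl.
by rewrite lerD ?support_fun_ge.
Qed.

(** The supremum has to be over a bounded set: by Cauchy-Schwarz, widths in unit directions are at
    most twice the largest norm of a point of [K]. *)
Lemma width_fun_le_max K x : compact K -> K !=set0 -> unit_sphere x ->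
  width_fun K x <= max_width K.
Proof.
move=> cK K0 ux; apply: ub_le_sup; last by exists x.
have [|c cK' cmax] :=
    @EVT_max_rV _ _ (fun y => dotv (y - 0) (y - 0)) K K0 cK.
  by apply: continuous_subspaceT; exact: dist_continuous.
exists (enorm c *+ 2) => _ [v uv <-].
have bound u y : unit_sphere u -> K y -> dotv u y <= enorm c.
  move=> uu Ky; rewrite (le_trans (dotv_le_enorm _ _)) // uu mul1r.
  by rewrite ler_sqrt ?dotv_ge0 //; have := cmax y (mem_set Ky); rewrite !subr0.
by rewrite mulr2n lerD // support_fun_le // => y Ky;
  apply: bound => //; exact: unit_sphereN.
Qed.

(** The width in the normalised direction of [y - z] is already at least [|y - z|]. *)
Lemma enorm_le_max_width K y z : compact K -> K y -> K z ->
  enorm (y - z) <= max_width K.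
Proof.
move=> cK Ky Kz; have K0 : K !=set0 by exists y.
have [/eqP e0|e0] := boolP (enorm (y - z) == 0); rewrite ?e0.
  (* For [y = z] there is nothing to normalise; any unit vector shows that the maximal width is
     nonnegative. *)
  have [j uj] : exists j : 'rV[R]_3, unit_sphere j.
    exists (delta_mx 0 0); apply/unit_sphereE.
    by rewrite dotvE !big_ord_recl big_ord0 !mxE /=; ring.
  apply: le_trans (width_fun_le_max cK K0 uj).
  by have := width_fun_ge j cK Ky Ky; rewrite subrr -(scale0r 0) dotvZr mul0r.
have u := unit_sphere_normalize (_ : y - z != 0); rewrite -enorm_eq0 in u.
apply: le_trans (width_fun_le_max cK K0 (u e0)).
apply: le_trans (width_fun_ge _ cK Ky Kz).
by rewrite dotvZl -enorm_sqr expr2 mulKf.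
Qed.

(** Equality case of Cauchy-Schwarz: points [p], [q] of [K] whose difference has maximal width as
    its component along [xi] differ by exactly that multiple of [xi]. Fixing one end then determines
    the other. *)
Lemma max_width_ends K xi : compact K -> K !=set0 -> unit_sphere xi ->
  width_fun K xi = max_width K ->
  exists z y, [/\ K z, K y,
    forall p, K p -> dotv xi p = support_fun K xi -> p = z &
    forall p, K p -> - dotv xi p = support_fun K (- xi) -> p = y].
Proof.
move=> cK K0 uxi hw.
have [z [y [Kz Ky hzy hz hy]]] := width_fun_dist xi cK K0.
have ends p q : K p -> K q -> dotv xi (p - q) = max_width K ->
    p - q = max_width K *: xi.
  (* With [D] the maximal width, [|p - q - D xi|^2 = |p - q|^2 - 2 D^2 + D^2 <= 0]. *)
  move=> Kp Kq hpq; apply/eqP; rewrite -subr_eq0 -dotv_eq0 eq_le dotv_ge0 andbT.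
  have := enorm_le_max_width cK Kp Kq.
  rewrite -(ler_pXn2r (n := 2)) ?nnegrE ?enorm_ge0 //; last first.
    by apply: le_trans (enorm_le_max_width cK Kp Kq); exact: enorm_ge0.
  rewrite enorm_sqr => h.
  rewrite -scaleNr dotv_sqD (dotvC _ xi) hpq ((unit_sphereE xi).1 uxi); lra.
exists z, y; split=> // p Kp hp.
- apply: (addIr (- y)); rewrite (ends _ _ Kz Ky) -?hzy //.
  by apply: ends => //; rewrite -hw hzy !dotvDr hp hz.
- apply: oppr_inj; apply: (addrI z); rewrite (ends _ _ Kz Ky) -?hzy //.
  by apply: ends => //; rewrite -hw hzy !dotvDr !dotvNr hp hy.
Qed.

End SupportFunction.

(** * Orthonormal frames and rotations about an axis *)

Section Frames.
Variable R : realType.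
Implicit Types (u v w x xi : 'rV[R]_3) (M : 'M[R]_3).

(** A 3 by 2 matrix has rank at most 2, hence a nonzero left kernel; [u] and [v] may be
    dependent. *)
Lemma exists_unit_orth u v :
  exists w, [/\ unit_sphere w, dotv w u = 0 & dotv w v = 0].
Proof.
pose A := (col_mx u v)^T.
have : kermx A != 0.
  by rewrite -mxrank_eq0 mxrank_ker subn_eq0 -ltnNge ltnS rank_leq_col.
move=> /rowV0Pn[c /sub_kermxP]; rewrite /A tr_col_mx mul_mx_row => cA c0.
exists ((enorm c)^-1 *: c); split; first exact: unit_sphere_normalize.
- have /(congr1 lsubmx) := cA; rewrite row_mxKl linear0 => cu.
  by rewrite dotvZl /dotv cu mxE mulr0.
- have /(congr1 rsubmx) := cA; rewrite row_mxKr linear0 => cv.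
  by rewrite dotvZl /dotv cv mxE mulr0.
Qed.

Definition frame3 u v w : 'M[R]_3 := \matrix_(i < 3) nth 0 [:: u; v; w] i.

Definition orthonormal3 u v w :=
  [/\ dotv u u = 1, dotv v v = 1 & dotv w w = 1] /\
  [/\ dotv u v = 0, dotv u w = 0 & dotv v w = 0].

Lemma frame3_orthogonal u v w : orthonormal3 u v w ->
  frame3 u v w *m (frame3 u v w)^T = 1%:M.
Proof.
move=> [[uu vv ww] [uv uw vw]]; apply/matrixP => i j.
have -> : (frame3 u v w *m (frame3 u v w)^T) i j =
    dotv (row i (frame3 u v w)) (row j (frame3 u v w)).
  by rewrite dotvE mxE; apply: eq_bigr => k _; rewrite !mxE.
rewrite !rowK mxE.
have [vu wu wv] : [/\ dotv v u = 0, dotv w u = 0 & dotv w v = 0].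
  by split; rewrite dotvC.
by case: i j => [[|[|[|//]]] ?] [[|[|[|//]]] ?] /=.
Qed.

(** For the square matrix [B] of the frame, [B B^T = 1] gives [B^T B = 1]; expand [x B^T B] along
    the rows of [B]. *)
Lemma orthonormal3_expand u v w x : orthonormal3 u v w ->
  x = dotv x u *: u + dotv x v *: v + dotv x w *: w.
Proof.
move=> /frame3_orthogonal/mulmx1C o; rewrite -[LHS]mulmx1 -o mulmxA.
rewrite mulmx_sum_row.
have E i : (x *m (frame3 u v w)^T) 0 i = dotv x (row i (frame3 u v w)).
  by rewrite dotvE mxE; apply: eq_bigr => k _; rewrite !mxE.
by rewrite !big_ord_recl big_ord0 !E !rowK /= addr0 addrA.
Qed.

(* The determinant forces the two eigenvalues of M on the orthogonal of w to
   agree. *)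
Lemma plane_rotation_scalar w xi M s : unit_sphere w -> unit_sphere xi ->
  dotv xi w = 0 -> plane_rotation w M -> s * s = 1 -> xi *m M = s *: xi ->
  forall x, dotv x w = 0 -> x *m M = s *: x.
Proof.
move=> /unit_sphereE uw /unit_sphereE uxi xiw [MM detM wM] ss xiM.
have [u [/unit_sphereE uu uw0 uxi0]] := exists_unit_orth w xi.
have o : orthonormal3 w u xi.
  by split; split=> //; rewrite dotvC.
have iso x y : dotv (x *m M) (y *m M) = dotv x y.
  by rewrite dotvMl -mulmxA MM mulmx1.
have s0 : s != 0.
  by apply/eqP => s0; move: ss; rewrite s0 mul0r => /esym/eqP; rewrite oner_eq0.
(* The image of [u] is orthogonal to the images [w] and [s xi] of the other two axes, so it stays on
   the line of [u]. *)
have uM : u *m M = dotv (u *m M) u *: u.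
  rewrite {1}(orthonormal3_expand (u *m M) o).
  have -> : dotv (u *m M) w = 0 by rewrite -wM iso.
  have -> : dotv (u *m M) xi = 0.
    by apply: (mulfI s0); rewrite mulr0 -dotvZr -xiM iso.
  by rewrite !scale0r add0r addr0.
set c := dotv (u *m M) u in uM.
pose B := frame3 w u xi.
(* In the frame [w], [u], [xi] the rotation is diagonal with entries [1, c, s], so that [c s] is its
   determinant 1. *)
have BM : B *m M = diag_mx (\row_i nth 0 [:: 1; c; s] i) *m B.
  apply/row_matrixP => i; rewrite row_mul mul_diag_mx.
  have -> : row i (\matrix_(k, j) ((\row_i nth 0 [:: 1; c; s] i) 0 k * B k j)) =
      nth 0 [:: 1; c; s] i *: row i B.
    by apply/rowP => j; rewrite !mxE.
  rewrite !rowK.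
  by case: i => [[|[|[|//]]] ?] /=; rewrite ?scale1r.
have cs : c * s = 1.
  have := congr1 (@determinant _ _) BM.
  rewrite !det_mulmx detM mulr1 det_diag !big_ord_recl big_ord0 !mxE /=.
  have Bunit : \det B != 0.
    have := congr1 (@determinant _ _) (frame3_orthogonal o).
    rewrite det_mulmx det_tr det1 => h.
    by apply/eqP => B0; move/eqP: h; rewrite -/B B0 mul0r eq_sym oner_eq0.
  by rewrite mul1r mulr1 -{1}[\det B]mul1r => /(mulIf Bunit).
have {}cs : c = s by apply: (mulIf s0); rewrite cs ss.
move=> x xw; rewrite (orthonormal3_expand x o) xw scale0r add0r.
by rewrite mulmxDl -!scalemxAl uM xiM cs scalerDr !scalerA !(mulrC s).
Qed.

End Frames.

(** * Closed subsets of the real line, up to countable sets *)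

Section RealLine.
Variable R : realType.
Implicit Types A B C : set R.

(** A point outside [A] would have an interval of the complement of [A] next to it, which lies in
    [C]; but a countable set has Lebesgue measure zero. *)
Lemma closed_co_countable A C : closed A -> countable C ->
  (forall t, ~ C t -> A t) -> forall t, A t.
Proof.
move=> cA cC CA t; apply: contrapT => nAt.
have /nbhs_ballP[e /= e0 eA] : nbhs t (~` A).
  by apply: open_nbhs_nbhs; split=> //; exact: closed_openC.
have sub : [set` `]t, t + e[] `<=` C.
  move=> s /=; rewrite in_itv /= => /andP[ts se]; apply: contrapT => /CA.
  apply: eA; rewrite /ball /= distrC gtr0_norm ?subr_gt0 //; lra.
have := countable_lebesgue_measure0 (sub_countable (subset_card_le sub) cC).
rewrite lebesgue_measure_itv /= lte_fin ltrDl e0 -EFinD => -[].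
by move: e0; lra.
Qed.

(** The closed set [A] union [B] is the whole line by density. Then [A] is the complement of [B],
    hence open and closed, and connectedness applies. *)
Lemma closed_cover_line A B C : closed A -> closed B -> countable C ->
  (forall t, A t -> ~ B t) -> (forall t, ~ C t -> A t \/ B t) ->
  (forall t, A t) \/ (forall t, B t).
Proof.
move=> cA cB cC dAB CAB.
have AB := closed_co_countable (closedU cA cB) cC CAB.
have conn : connected [set: R] by apply/connected_intervalP.
have [A0|nA] := pselect (A !=set0); last first.
  by right => t; have [At|//] := AB t; case: nA; exists t.
left => t; suff -> : A = setT by [].
apply: conn => //; last by exists A => //; rewrite setTI.
exists (~` B); first exact: closed_openC.
rewrite setTI; apply/seteqP; split=> [s /dAB//|s /= nB].
by have [] := AB s.
Qed.

End RealLine.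

(** * Projections of bodies, seen through support functions *)

Section Projections.
Variable R : realType.
Implicit Types (K L : set 'rV[R]_3) (w x y : 'rV[R]_3) (M : 'M[R]_3).

Lemma dotv_proj w x y : dotv x (y - dotv y w *: w) = dotv (x - dotv x w *: w) y.
Proof. by rewrite !dotv_linE (dotvC y w) (dotvC w y); ring. Qed.

Lemma dotv_proj_orth w x y : dotv x w = 0 ->
  dotv x (y - dotv y w *: w) = dotv x y.
Proof. by move=> xw; rewrite !dotv_linE xw mulr0 subr0. Qed.

Lemma proj_orth w x : unit_sphere w -> dotv (x - dotv x w *: w) w = 0.
Proof. by move=> /unit_sphereE uw; rewrite !dotv_linE uw mulr1 subrr. Qed.

Lemma compact_orth_proj w K : compact K -> compact (orth_proj w K).
Proof.
move=> cK; apply: continuous_compact cK; apply: continuous_subspaceT => x.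
apply: (@continuousB R _ _ id (fun y => dotv y w *: w)); first exact: cvg_id.
apply: (@continuousZr_tmp R _ _ (fun y => dotv y w)).
have -> : (fun y => dotv y w) = dotv w by apply/funext => y; rewrite dotvC.
exact: dotv_continuous.
Qed.

Lemma convex_orth_proj w K : convex_set K -> convex_set (orth_proj w K).
Proof.
move=> vK p q l /set_mem[x Kx <-] /set_mem[y Ky <-]; apply/mem_set.
exists (l%:num *: x + (1 - l%:num) *: y).
  by apply: convex_setP => //; exact: le1.
rewrite dotvDl !dotvZl; set t := l%:num.
rewrite -[RHS]/(t *: (x - dotv x w *: w) + (1 - t) *: (y - dotv y w *: w)).
by apply/rowP => i; rewrite !mxE; ring.
Qed.

(** On the plane orthogonal to [w], a body and its projection have the same support function; the
    rotation moves to the argument as its transpose. *)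
Lemma support_fun_congr w K L M a : compact K -> compact L ->
  K !=set0 -> L !=set0 -> unit_sphere w -> plane_rotation w M ->
  [set x *m M + a | x in orth_proj w K] = orth_proj w L ->
  forall x, dotv x w = 0 ->
    support_fun L x = dotv x a + support_fun K (x *m M^T).
Proof.
move=> cK cL K0 L0 uw [_ _ wM] KL x xw.
have xMw : dotv (x *m M^T) w = 0 by rewrite dotvMl trmxK wM.
(* Points with corresponding projections have corresponding products with [x]; this serves both
   inequalities. *)
have key k l : k \in K -> (k - dotv k w *: w) *m M + a = l - dotv l w *: w ->
    dotv x l = dotv x a + dotv (x *m M^T) k.
  move=> Kk h; rewrite -(dotv_proj_orth l xw) -h dotvDr addrC; congr (_ + _).
  by rewrite -(dotv_proj_orth k xMw) dotvMl trmxK.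
apply/eqP; rewrite eq_le; apply/andP; split.
- apply: support_fun_le => // l Ll.
  have : orth_proj w L (l - dotv l w *: w) by exists l.
  rewrite -KL => -[_ [k Kk <-] /(key _ _ (mem_set Kk)) ->].
  by rewrite lerD2l support_fun_ge.
- rewrite -lerBrDl; apply: support_fun_le => // k Kk; rewrite lerBrDl.
  have : orth_proj w L ((k - dotv k w *: w) *m M + a).
    by rewrite -KL; exists (k - dotv k w *: w) => //; exists k.
  by move=> [l Ll /esym/(key _ _ (mem_set Kk)) <-]; exact: support_fun_ge.
Qed.

(** The hypothesis says that the projection and its reflection have the same support function, and a
    compact convex set is determined by it. *)
Lemma centrally_symmetric_proj w K b : convex_body K -> unit_sphere w ->
  (forall x, dotv x w = 0 ->
    support_fun K x = support_fun K (- x) + dotv x b) ->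
  centrally_symmetric (orth_proj w K).
Proof.
move=> [cK vK iK] uw hb.
have K0 : K !=set0 by case: iK => x /interior_subset; exists x.
(* The centre is half of the component of [b] in the plane, the only part of [b] seen by the
   hypothesis. *)
pose c := 2^-1 *: (b - dotv b w *: w).
have c2 : c *+ 2 = b - dotv b w *: w.
  by rewrite -scaler_nat scalerA mulfV ?pnatr_eq0 // scale1r.
have sub p : orth_proj w K p -> orth_proj w K (c *+ 2 - p).
  move=> [k Kk <-]; apply: mem_support_fun; first exact: compact_orth_proj.
  - exact: convex_orth_proj.
  - by case: K0 => y Ky; exists (y - dotv y w *: w), y.
  (* Membership is tested against all vectors of space, but only the component [x'] of [x] in the
     plane matters. *)
  move=> x; pose x' := x - dotv x w *: w.
  have x'w : dotv x' w = 0 by exact: proj_orth.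
  have [y Ky hy] := support_fun_attained x' cK K0.
  have : orth_proj w K (y - dotv y w *: w) by exists y.
  move/(support_fun_ge x (compact_orth_proj (w:=w) cK)); apply: le_trans.
  rewrite dotv_proj c2 dotvDr dotvNr !dotv_proj -/x' -hy hb // addrC.
  by rewrite lerD2r -dotvNl support_fun_ge.
exists c; apply/seteqP; split=> [_ [p Kp <-]|p Kp]; first exact: sub.
by exists (c *+ 2 - p); [exact: sub | rewrite opprB addrC subrK].
Qed.

End Projections.

(** * Functions vanishing on a pencil of planes *)

(* The planes (e1 + t e2)^perp are all the planes containing xi except e2^perp,
   which is recovered by continuity. *)
Section Pencil.
Variables (R : realType) (f : 'rV[R]_3 -> R) (e1 e2 xi : 'rV[R]_3).
Hypothesis f_line : forall p q, continuous (fun t : R => f (p + t *: q)).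
Hypothesis frame : orthonormal3 e1 e2 xi.

Definition vanishes_on_plane (t : R) :=
  forall x, dotv x (e1 + t *: e2) = 0 -> f x = 0.

(** With the normal left unnormalised, the plane is parametrised by [(a, b)] so that each point
    moves along a line as [t] varies. Closedness in [t] then needs continuity on lines only. *)
Lemma vanishes_on_planeP t : vanishes_on_plane t <->
  forall ab : R * R, f (ab.1 *: e2 + ab.2 *: xi + t *: (- ab.1 *: e1)) = 0.
Proof.
have [[u1 u2 _] [u12 u1x u2x]] := frame.
split=> h => [[a b]|x xt].
  apply: h; rewrite !dotv_linE /= (dotvC e2 e1) (dotvC xi e1) (dotvC xi e2).
  by rewrite u1 u2 u12 u1x u2x; ring.
rewrite -(h (dotv x e2, dotv x xi)) {1}(orthonormal3_expand x frame) /=.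
move: xt; rewrite dotvDr dotvZr => /eqP; rewrite addr_eq0 => /eqP ->.
congr f; rewrite scalerA mulrN [RHS]addrC addrA.
by [].
Qed.

Lemma closed_vanishes_on_plane : closed [set t | vanishes_on_plane t].
Proof.
have -> : [set t | vanishes_on_plane t] = \bigcap_(ab in [set: R * R])
    (fun t => f (ab.1 *: e2 + ab.2 *: xi + t *: (- ab.1 *: e1))) @^-1`
      [set r | r = 0].
  apply/seteqP; split=> t /=.
    by move=> /vanishes_on_planeP h ab _; exact: h.
  by move=> h; apply/vanishes_on_planeP => ab; exact: h.
apply: closed_bigI => ab _; apply: preimage_closed; last exact: closed_eq.
by move=> t _; exact: f_line.
Qed.

(** A vector with nonzero [e2] component lies in one of the planes. The line through [x] along [e2]
    has a single point without this property, which continuity recovers. *)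
Lemma vanishes_everywhere :
  (forall t, vanishes_on_plane t) -> forall x, f x = 0.
Proof.
move=> h x; have [[_ u2 _] _] := frame.
have cl : closed ((fun s => f (x + s *: e2)) @^-1` [set r | r = 0]).
  by apply: preimage_closed; [move=> t _; exact: f_line | exact: closed_eq].
have co := closed_co_countable cl (countable1 (- dotv x e2)).
rewrite -[x]addr0 -(scale0r e2); apply: co => s /eqP s0 /=.
have y0 : dotv (x + s *: e2) e2 != 0.
  by rewrite dotvDl dotvZl u2 mulr1 addrC addr_eq0.
(* This parameter makes the normal orthogonal to [x + s e2]. *)
apply: (h (- dotv (x + s *: e2) e1 / dotv (x + s *: e2) e2)).
by rewrite dotvDr dotvZr mulfVK // subrr.
Qed.

End Pencil.

(** * Recovering a body from support data *)

Section Reconstruction.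
Variable R : realType.
Implicit Types (K L : set 'rV[R]_3) (s t : R) (b x xi w : 'rV[R]_3).

(** The subtracted terms form the support function of [s K + b] at [x], so the gap compares [L] with
    [s K + b]. *)
Definition support_gap K L s b x :=
  support_fun L x - support_fun K (s *: x) - dotv x b.

Lemma support_gap_line K L s b : compact K -> compact L ->
  K !=set0 -> L !=set0 ->
  forall p q, continuous (fun t => support_gap K L s b (p + t *: q)).
Proof.
move=> cK cL K0 L0 p q t; rewrite /support_gap.
have -> : (fun t => support_fun L (p + t *: q) -
      support_fun K (s *: (p + t *: q)) - dotv (p + t *: q) b) =
    (fun t => support_fun L (p + t *: q) -
      support_fun K (s *: p + t *: (s *: q)) - (dotv p b + t * dotv q b)).
  apply/funext => r; congr (_ - support_fun K _ - _); last by rewrite !dotv_linE.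
  by rewrite scalerDr !scalerA mulrC.
have cf : continuous (fun r : R => support_fun L (p + r *: q)).
  exact: support_fun_line_continuous.
have cg : continuous (fun r : R => support_fun K (s *: p + r *: (s *: q))).
  exact: support_fun_line_continuous.
have ch : continuous (fun t : R => dotv p b + t * dotv q b).
  move=> r.
  apply: (@continuousD R _ _ (fun=> dotv p b) (fun r : R => r * dotv q b)).
    exact: cst_continuous.
  exact: mulrr_continuous.
exact: (continuousB (continuousB (cf t) (cg t)) (ch t)).
Qed.

Lemma support_gap_eq0 K L s b : convex_body K -> convex_body L -> s * s = 1 ->
  (forall x, support_gap K L s b x = 0) -> K = [set s *: (x - b) | x in L].
Proof.
move=> [cK vK iK] [cL vL iL] ss h.
have K0 : K !=set0 by case: iK => x /interior_subset; exists x.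
have L0 : L !=set0 by case: iL => x /interior_subset; exists x.
have {}h x : support_fun L x = support_fun K (s *: x) + dotv x b.
  by have := h x; rewrite /support_gap; lra.
apply/seteqP; split=> [k Kk|_ [l Ll <-]].
  exists (s *: k + b); last by rewrite addrK scalerA ss scale1r.
  apply: mem_support_fun => // x; rewrite h dotvDr lerD2r.
  by rewrite dotvZr -dotvZl support_fun_ge.
apply: mem_support_fun => // x.
have := support_fun_ge (s *: x) cL Ll.
rewrite h scalerA ss scale1r !dotvZl dotvZr dotvDr dotvNr; lra.
Qed.

(** If the diameter has difference [c xi], its length is [|c|], while the width along [xi] is at
    least [c] and at least [-c]. *)
Lemma diameter_width K xi : convex_body K -> unit_sphere xi ->
  has_diameter_along K xi -> width_fun K xi = max_width K.
Proof.
move=> [cK vK iK] uxi [z [y [[sub D] [c zy]]]].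
have K0 : K !=set0 by case: iK => x /interior_subset; exists x.
have Kz : K z.
  apply: sub; exists 0; first by rewrite /= in_itv /= lexx ler01.
  by rewrite subr0 scale1r scale0r addr0.
have Ky : K y.
  apply: sub; exists 1; first by rewrite /= in_itv /= lexx ler01.
  by rewrite subrr scale0r scale1r add0r.
apply/eqP; rewrite eq_le width_fun_le_max //= -D.
have h1 := width_fun_ge xi cK Kz Ky; have h2 := width_fun_ge xi cK Ky Kz.
have xx := (unit_sphereE xi).1 uxi.
rewrite zy dotvZr xx mulr1 in h1.
rewrite -opprB zy dotvNr dotvZr xx mulr1 in h2.
have -> : enorm (z - y) = `|c|.
  by rewrite /enorm zy dotvZl dotvZr xx mulr1 -expr2 sqrtr_sqr.
by rewrite ler_norml; apply/andP; split; lra.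
Qed.

End Reconstruction.

(** * Directions of maximal width under the congruences *)

Section Congruence.
Variables (R : realType) (K L : set 'rV[R]_3) (xi : 'rV[R]_3).
Hypotheses (hK : convex_body K) (hL : convex_body L) (uxi : unit_sphere xi).
Hypothesis hdiam : has_diameter_along K xi.
Hypothesis hcongr : forall w : 'rV[R]_3, unit_sphere w -> orth_plane xi w ->
  directly_congruent w (orth_proj w K) (orth_proj w L).

Let cK : compact K. Proof. by case: hK. Qed.
Let cL : compact L. Proof. by case: hL. Qed.
Let K0 : K !=set0.
Proof. by case: hK => _ _ [x /interior_subset]; exists x. Qed.
Let L0 : L !=set0.
Proof. by case: hL => _ _ [x /interior_subset]; exists x. Qed.

(** The contributions of the translation at [x] and [-x] cancel. *)
Lemma width_fun_congr w M a : unit_sphere w -> plane_rotation w M ->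
  [set x *m M + a | x in orth_proj w K] = orth_proj w L ->
  forall x, dotv x w = 0 -> width_fun L x = width_fun K (x *m M^T).
Proof.
move=> uw rM KL x xw.
have xw' : dotv (- x) w = 0 by rewrite dotvNl xw oppr0.
rewrite /width_fun !(support_fun_congr cK cL K0 L0 uw rM KL) //.
by rewrite dotvNl mulNmx addrACA subrr add0r.
Qed.

Lemma unit_sphere_rot (M : 'M[R]_3) (x : 'rV[R]_3) : M *m M^T = 1%:M ->
  unit_sphere x -> unit_sphere (x *m M).
Proof.
move=> MM /unit_sphereE ux; apply/unit_sphereE.
by rewrite dotvMl -mulmxA MM mulmx1.
Qed.

(** The width of [L] at [xi M] is that of [K] at [xi], the maximal width of [K]. No width of [L]
    exceeds this, since each one is also a width of [K]. *)
Lemma max_width_congr w M a : unit_sphere w -> dotv xi w = 0 ->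
  plane_rotation w M ->
  [set x *m M + a | x in orth_proj w K] = orth_proj w L ->
  width_fun L (xi *m M) = max_width L.
Proof.
move=> uw xiw rM KL; have [MM _ wM] := rM.
have xiMw : dotv (xi *m M) w = 0 by rewrite -wM dotvMl -mulmxA MM mulmx1.
apply/eqP; rewrite eq_le width_fun_le_max //=; last exact: unit_sphere_rot.
rewrite (width_fun_congr uw rM KL) // -mulmxA MM mulmx1 (diameter_width hK) //.
apply: ge_sup; first by exists (width_fun L xi), xi.
move=> _ [x ux <-].
(* The plane orthogonal to [v] contains both [x] and [xi], so its congruence carries the width at
   [x] back to [K]. *)
have [v [uv vx vxi]] := exists_unit_orth x xi.
have [N [c [rN _ KLv]]] := hcongr uv vxi.
rewrite (width_fun_congr uv rN KLv) 1?dotvC // width_fun_le_max //.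
apply: unit_sphere_rot => //; rewrite trmxK.
by have [NN _ _] := rN; exact: mulmx1C.
Qed.

End Congruence.

(** * Congruences whose rotation is plus or minus the identity *)

Section ScalarCongruence.
Variables (R : realType) (K L : set 'rV[R]_3) (w xi a : 'rV[R]_3) (s : R).
Variable M : 'M[R]_3.
Hypotheses (cK : compact K) (cL : compact L) (K0 : K !=set0) (L0 : L !=set0).
Hypotheses (uw : unit_sphere w) (uxi : unit_sphere xi) (xiw : dotv xi w = 0).
Hypothesis rM : plane_rotation w M.
Hypothesis KL : [set x *m M + a | x in orth_proj w K] = orth_proj w L.
Hypotheses (ss : s * s = 1) (xiM : xi *m M = s *: xi).

Let scalM x : dotv x w = 0 -> x *m M = s *: x.
Proof. exact: plane_rotation_scalar xiM x. Qed.

Lemma support_fun_scalar_congr x : dotv x w = 0 ->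
  support_fun L x = dotv x a + support_fun K (s *: x).
Proof.
move=> xw; rewrite (support_fun_congr cK cL K0 L0 uw rM KL) //.
have [MM _ _] := rM; congr (_ + support_fun K _).
(* Since [M M^T = 1] and [s s = 1], the transpose of [M] also acts on [x] as [s]. *)
by rewrite -[x in RHS]mulmx1 -MM mulmxA scalM // -scalemxAl scalerA ss scale1r.
Qed.

Lemma scalar_congr_image k : K k -> exists2 l, L l &
  forall x, dotv x w = 0 -> dotv x l = s * dotv x k + dotv x a.
Proof.
move=> Kk; have kw := proj_orth k uw.
have : orth_proj w L ((k - dotv k w *: w) *m M + a).
  by rewrite -KL; exists (k - dotv k w *: w) => //; exists k.
move=> [l Ll lE]; exists l => // x xw.
by rewrite -(dotv_proj_orth l xw) lE dotvDr scalM // dotvZr dotv_proj_orth.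
Qed.

(** The point [l] of [L] matching [zK] is extreme along [xi], at the top if [s = 1] and at the
    bottom if [s = -1]. Uniqueness identifies it with [zL] or [yL], which expresses [a] on the plane
    by vectors independent of [w]. *)
Lemma scalar_congr_gap zK zL yL : K zK -> support_fun K xi = dotv xi zK ->
  (forall p, L p -> dotv xi p = support_fun L xi -> p = zL) ->
  (forall p, L p -> - dotv xi p = support_fun L (- xi) -> p = yL) ->
  (forall x, dotv x w = 0 -> support_gap K L 1 (zL - zK) x = 0) \/
  (forall x, dotv x w = 0 -> support_gap K L (- 1) (yL + zK) x = 0).
Proof.
move=> Kz hz topL botL.
have [l Ll lE] := scalar_congr_image Kz.
have /eqP : s ^+ 2 = 1 by rewrite expr2.
rewrite sqrf_eq1 => /orP[] /eqP sE; [left | right] => x xw;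
  rewrite /support_gap support_fun_scalar_congr // sE.
- have <- : l = zL.
    apply: topL => //; rewrite lE // support_fun_scalar_congr // sE scale1r hz.
    by ring.
  by rewrite dotvDr dotvNr lE // sE; ring.
- have <- : l = yL.
    apply: botL => //; rewrite lE // support_fun_scalar_congr; last first.
      by rewrite dotvNl xiw oppr0.
    by rewrite sE scaleN1r opprK hz dotvNl; ring.
  by rewrite dotvDr lE // sE; ring.
Qed.

End ScalarCongruence.

Theorem theorem4 (R : realType) (K L : set 'rV[R]_3) (xi0 : 'rV[R]_3)
    (hK : convex_body K) (hL : convex_body L)
    (hKd : countably_many_diameters K) (hLd : countably_many_diameters L)
    (hxi0 : unit_sphere xi0) (hdiam : has_diameter_along K xi0)
    (hcongr : forall w : 'rV[R]_3, unit_sphere w -> orth_plane xi0 w ->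
      directly_congruent w (orth_proj w K) (orth_proj w L))
    (hsym : forall w : 'rV[R]_3, unit_sphere w -> orth_plane xi0 w ->
      ~ centrally_symmetric (orth_proj w K) /\ ~ centrally_symmetric (orth_proj w L)) :
  exists b : 'rV[R]_3,
    K = [set x + b | x in L] \/ K = [set - x + b | x in L].
Proof.
have [[cK _ iK] [cL _ iL]] := (hK, hL).
have K0 : K !=set0 by case: iK => x /interior_subset; exists x.
have L0 : L !=set0 by case: iL => x /interior_subset; exists x.
have xx := (unit_sphereE xi0).1 hxi0.
have [e1 [/unit_sphereE u1 e1x _]] := exists_unit_orth xi0 xi0.
have [e2 [/unit_sphereE u2 e2x e21]] := exists_unit_orth xi0 e1.
have frame : orthonormal3 e1 e2 xi0 by split; split=> //; rewrite dotvC.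
pose W t := e1 + t *: e2.
have W0 t : W t != 0.
  apply/eqP => Wt; have : dotv (W t) e1 = 1 by rewrite !dotv_linE u1 e21; ring.
  by rewrite Wt -(scale0r 0) dotvZl mul0r => /eqP; rewrite eq_sym oner_eq0.
pose w t := (enorm (W t))^-1 *: W t.
have uw t : unit_sphere (w t) by exact: unit_sphere_normalize.
have wW t x : dotv x (w t) = 0 <-> dotv x (W t) = 0.
  rewrite dotvZr; split=> [/eqP|->]; last by rewrite mulr0.
  by rewrite mulf_eq0 invr_eq0 enorm_eq0 (negbTE (W0 t)) => /eqP.
have xw t : dotv xi0 (w t) = 0.
  by apply/wW; rewrite dotvC dotvDl dotvZl e1x e2x mulr0 addr0.
have wx t : orth_plane xi0 (w t) by rewrite /orth_plane /= dotvC.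
pose T := [set t | unit_sphere t /\ width_fun L t = max_width L].
(* If [th.e2] is nonzero, this quotient is the only [t] with [th] orthogonal to [W t]. Otherwise
   division by zero merely puts 0 into [C]. *)
pose C := (fun th => - dotv th e1 / dotv th e2) @` T.
have cC : countable C by apply: sub_countable (card_image_le _ _) hLd.
have good t : ~ C t -> exists s M a, [/\ s * s = 1, plane_rotation (w t) M,
    [set x *m M + a | x in orth_proj (w t) K] = orth_proj (w t) L,
    xi0 *m M = s *: xi0 & width_fun L (xi0 *m M) = max_width L].
  move=> nC; have [M [a [rM _ KL]]] := hcongr _ (uw t) (wx t).
  have [MM _ wM] := rM.
  have wid := max_width_congr hK hL hxi0 hdiam hcongr (uw t) (xw t) rM KL.
  have uth := unit_sphere_rot MM hxi0.
  have thW : dotv (xi0 *m M) (W t) = 0.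
    by apply/wW; rewrite -wM dotvMl -mulmxA MM mulmx1.
  set th := xi0 *m M in wid uth thW *.
  (* A nonzero [e2] component would make [t] the exceptional parameter of the maximal direction
     [th]. Hence [th] is a multiple of [xi0]. *)
  have th2 : dotv th e2 = 0.
    apply/eqP; apply: contrapT => /negP th2; apply: nC; exists th => //.
    move: thW; rewrite dotvDr dotvZr => /eqP; rewrite addr_eq0 => /eqP ->.
    by rewrite opprK mulfK.
  have th1 : dotv th e1 = 0 by move: thW; rewrite dotvDr dotvZr th2 mulr0 addr0.
  have thE : th = dotv th xi0 *: xi0.
    by rewrite {1}(orthonormal3_expand th frame) th1 th2 !scale0r !add0r.
  exists (dotv th xi0), M, a; split=> //.
  by move/unit_sphereE: uth; rewrite {1 2}thE dotvZl dotvZr xx mulr1.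
(* One good parameter shows that [L] also has maximal width along [xi0]. It exists because otherwise
   the empty set, being closed, would contain every real. *)
have [t0 /good[s0 [M0 [a0 [ss0 _ _ xiM0]]]]] : exists t0, ~ C t0.
  apply: contrapT => nex.
  apply: (closed_co_countable (@closed0 R^o) cC _ 0) => t nC.
  by apply: nex; exists t.
rewrite xiM0 => wid0.
have widL : width_fun L xi0 = max_width L.
  have /eqP : s0 ^+ 2 = 1 by rewrite expr2.
  rewrite sqrf_eq1 => /orP[] /eqP sE; move: wid0; rewrite sE.
    by rewrite scale1r.
  by rewrite scaleN1r width_funN.
have [zL [yL [_ _ topL botL]]] := max_width_ends cL L0 hxi0 widL.
have [zK Kz hz] := support_fun_attained xi0 cK K0.
pose A := vanishes_on_plane (support_gap K L 1 (zL - zK)) e1 e2.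
pose B := vanishes_on_plane (support_gap K L (- 1) (yL + zK)) e1 e2.
have cover t : ~ C t -> A t \/ B t.
  move=> /good[s [M [a [ss rM KL xiM _]]]].
  have [h|h] := scalar_congr_gap cK cL K0 L0 (uw t) hxi0 (xw t) rM KL ss xiM
    Kz hz topL botL; [left | right] => x /wW; exact: h.
have disj t : A t -> ~ B t.
  move=> At Bt; have [nsym _] := hsym _ (uw t) (wx t); apply: nsym.
  (* Eliminating [support_fun L x] from the two alternatives relates [support_fun K] at [x] and
     [-x], with [b] the difference of the two translations. *)
  apply: (centrally_symmetric_proj (b := (yL + zK) - (zL - zK)) hK (uw t)) => x.
  move=> /wW xW; have := At x xW; have := Bt x xW; rewrite /support_gap.
  by rewrite scaleN1r scale1r [in X in _ -> _ -> X]dotvDr dotvNr; lra.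
have gap_line s b := @support_gap_line _ K L s b cK cL K0 L0.
have [/vanishes_everywhere|/vanishes_everywhere] := closed_cover_line
    (closed_vanishes_on_plane (gap_line 1 (zL - zK)) frame)
    (closed_vanishes_on_plane (gap_line (- 1) (yL + zK)) frame) cC disj cover.
- move=> /(_ _ (gap_line _ _) frame)/(support_gap_eq0 hK hL (mulr1 1)) KE.
  (* The gap places [L] relative to [K]; solving for [K] reverses the translation here, whereas for
     [s = -1] the vector stays the same. *)
  exists (- (zL - zK)); left; rewrite KE.
  by apply: eq_imagel => x _; rewrite scale1r.
- have N1 : (- 1) * (- 1) = 1 :> R by rewrite mulrNN mulr1.
  move=> /(_ _ (gap_line _ _) frame)/(support_gap_eq0 hK hL N1) KE.
  exists (yL + zK); right; rewrite KE.
  by apply: eq_imagel => x _; rewrite scaleN1r opprB addrC.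
Qed.
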